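(* The exponent of matrix multiplication $\omega$ and the s-rank exponent of matrix multiplication $\omega_s$ satisfy $$\omega \le \frac{3\omega_s - 2}{2}.$$
   Context: A third-order tensor over $\mathbb{C}$ is written as a trilinear form $T=\sum_{i,j,k} T_{i,j,k}\,\hat x_i\hat y_j\hat z_k$ in three disjoint finite sets of formal variables, with coefficients $T_{i,j,k}\in\mathbb{C}$. Its rank $R(T)$ is the least $r$ such that $T=\sum_{\ell=1}^r \alpha_\ell(\hat x)\beta_\ell(\hat y)\gamma_\ell(\hat z)$ with $\alpha_\ell,\beta_\ell,\gamma_\ell$ linear forms. The support $\mathrm{supp}(T)$ is the set of monomials with nonzero coefficient in $T$ (with respect to the given variables). The s-rank $R_s(T)$ is the minimum of $R(T')$ over all tensors $T'$ in the same variables with $\mathrm{supp}(T')=\mathrm{supp}(T)$. The matrix multiplication tensor is $\langle \ell,m,n\rangle=\sum_{i=1}^{\ell}\sum_{j=1}^m\sum_{k=1}^n \hat x_{i,j}\hat y_{j,k}\hat z_{k,i}$. The exponents are $$\omega=\inf\{\tau\in\mathbb{R}: R(\langle n,n,n\rangle)=O(n^\tau)\},\qquad \omega_s=\inf\{\tau\in\mathbb{R}: R_s(\langle n,n,n\rangle)=O(n^\tau)\}.$$ *)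

(* Defs.v *)
From HB Require Import structures.
From mathcomp Require Import all_boot all_order all_algebra.
From mathcomp Require Import complex.
From mathcomp Require Import all_classical all_reals all_analysis.
Set Implicit Arguments.
Unset Strict Implicit.
Unset Printing Implicit Defensive.
Import Order.TTheory GRing.Theory Num.Theory.
Import numFieldNormedType.Exports.
Local Open Scope ring_scope.
Local Open Scope classical_set_scope.

(* A trilinear form in the variables (x_i), (y_j), (z_k) is represented by its
   array of coefficients, a linear form by its vector of coefficients. *)
Definition tensor (F : fieldType) (I J K : finType) := {ffun I * J * K -> F}.

Definition linear_form (F : fieldType) (I : finType) := {ffun I -> F}.

Definition form_var (F : fieldType) (I : finType) (i : I) : linear_form F I :=
  [ffun i' => (i' == i)%:R].

Definition form_prod (F : fieldType) (I J K : finType)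
    (a : linear_form F I) (b : linear_form F J) (c : linear_form F K) :
    tensor F I J K :=
  [ffun t => a t.1.1 * b t.1.2 * c t.2].

Definition rank_decomposition (F : fieldType) (I J K : finType)
    (T : tensor F I J K) (r : nat) : Prop :=
  exists (a : 'I_r -> linear_form F I) (b : 'I_r -> linear_form F J)
         (c : 'I_r -> linear_form F K),
    T = \sum_(l < r) form_prod (a l) (b l) (c l).

Lemma rank_decomposition_ex (F : fieldType) (I J K : finType)
  (T : tensor F I J K) : exists r, `[< rank_decomposition T r >].
Proof.
exists #|{: I * J * K}|; apply/asboolP.
exists (fun l => [ffun i => T (enum_val l) * (i == (enum_val l).1.1)%:R]).
exists (fun l => form_var F (enum_val l).1.2).
exists (fun l => form_var F (enum_val l).2).
apply/ffunP => t; rewrite sum_ffunE (bigD1 (enum_rank t)) //= big1.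
  by rewrite !ffunE enum_rankK !eqxx !mulr1 addr0.
move=> l ne_lt; have ne_t : t != enum_val l.
  by apply: contraNneq ne_lt => ->; rewrite enum_valK.
rewrite !ffunE; move: (T _) ne_t; case: (enum_val l) => [[i j] k] c.
case: t ne_lt => [[i' j'] k'] _ /=; rewrite !xpair_eqE.
by do 3 case: eqP => _ //=; rewrite ?mulr0 ?mul0r.
Qed.

Definition tensor_rank (F : fieldType) (I J K : finType)
    (T : tensor F I J K) : nat :=
  ex_minn (rank_decomposition_ex T).

Definition tensor_supp (F : fieldType) (I J K : finType)
    (T : tensor F I J K) : {set I * J * K} :=
  [set t | T t != 0]%SET.

Definition supp_rank (F : fieldType) (I J K : finType)
    (T : tensor F I J K) (r : nat) : Prop :=
  exists2 T' : tensor F I J K,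
    tensor_supp T' = tensor_supp T & tensor_rank T' = r.

Lemma supp_rank_ex (F : fieldType) (I J K : finType)
  (T : tensor F I J K) : exists r, `[< supp_rank T r >].
Proof. by exists (tensor_rank T); apply/asboolP; exists T. Qed.

Definition s_rank (F : fieldType) (I J K : finType)
    (T : tensor F I J K) : nat :=
  ex_minn (supp_rank_ex T).

Definition matmul_tensor (F : fieldType) (l m n : nat) :
    tensor F ('I_l * 'I_m)%type ('I_m * 'I_n)%type ('I_n * 'I_l)%type :=
  \sum_(i < l) \sum_(j < m) \sum_(k < n)
    form_prod (form_var F (i, j)) (form_var F (j, k)) (form_var F (k, i)).

(* [inf] is 0 on sets that are empty or unbounded below. For both functions used
   here, 1 <= f n <= n ^ 6 when 0 < n, so the set contains 6 and is bounded
   below by 0, and [inf] is the genuine infimum. *)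
Definition growth_exponent (R : realType) (f : nat -> nat) : R :=
  inf [set tau : R |
    (fun n : nat => (f n)%:R : R^o) =O_\oo (fun n : nat => n%:R `^ tau : R^o)].

Definition omega (R : realType) : R :=
  growth_exponent R (fun n => tensor_rank (matmul_tensor R[i] n n n)).

Definition omega_s (R : realType) : R :=
  growth_exponent R (fun n => s_rank (matmul_tensor R[i] n n n)).

(* Main.v *)
Require Import Defs.
From mathcomp Require Import all_boot all_order all_algebra.
From mathcomp Require Import complex.
From mathcomp Require Import all_classical all_reals all_analysis.
From mathcomp Require Import zify ring lra.
Set Implicit Arguments.
Unset Strict Implicit.
Unset Printing Implicit Defensive.
Import Order.TTheory GRing.Theory Num.Theory.
Local Open Scope ring_scope.

(** Let [T] be a tensor with the support of <n,n,n> whose rank is the s-rank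
    [r] of <n,n,n>. Its coefficients [T_ijk] are arbitrary nonzero numbers, and
    in general no rescaling of the variables turns them all into 1. Fixing one
    of the three indices changes this: if [k] is fixed, then [T_ijk] depends
    only on the pair (i, j) that names the variable [x_ij], and dividing [x_ij]
    by it gives the plain tensor <n,n,1>. The same holds for the other two
    indices.

    The third tensor power of [T] exploits this three times at once
    ([rank_le_copies_cube]). The third index of the first factor, the second
    index of the second factor and the first index of the third factor are
    frozen to the corners of a triple (i, j, k) from a set [E] of triples, and
    all other indices stay free. If [E] is such that three pairs (i, j), (j, k),
    (k, i) coming from members of [E] can close up to a triangle only when they
    come from one and the same member ([triangle_matching]), then different
    members of [E] never interact. The restriction is a direct sum of #|E|
    copies of the product of <n,n,1>, <n,1,n> and <1,n,n>, that is, of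
    <n^2,n^2,n^2>. So #|E| independent copies of <n^2,n^2,n^2> have rank at most
    [r ^ 3].

    Such a set [E] can have n^(2-o(1)) elements ([triangle_matching_sphere]).
    As in Behrend's construction, the triples are (x, x + a, x + 2a) for [x] and
    [a] in a box of Z^k, with [a] on a sphere: a closed triangle from three
    members with steps [a], [b], [c] forces a + b = 2c, and a sphere contains no
    midpoint of two of its distinct points.

    Schoenhage's argument for a direct sum of equal matrix products then gives
    #|E| * n^(2 omega) <= 2 * r^3 ([omega_le_triangle_matching]): if [s] copies
    of <m,m,m> have rank at most [q * s], then the [q * s] products of a
    decomposition can be carried out on blocks, in [q] batches of [s]
    independent block products, and each batch is again an instance of the same
    problem. Hence [s] copies of <m^N,m^N,m^N> have rank at most [q ^ N * s],
    and omega <= log_m q.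

    With #|E| = n^(2-o(1)) and r = O(n^tau) this reads 2 + 2 omega <= 3 tau,
    and the infimum over [tau] is the theorem. *)

(** * Rank of arrays of coefficients *)

Section Rank.
Variable F : fieldType.

(** Plain functions instead of finite functions: tensor products, direct sums
    and restrictions of tensors are then just compositions. *)
Definition rank_le (I J K : finType) (t : I -> J -> K -> F) (r : nat) : Prop :=
  exists (a : 'I_r -> I -> F) (b : 'I_r -> J -> F) (c : 'I_r -> K -> F),
    forall i j k, t i j k = \sum_l a l i * b l j * c l k.

(** Lets a rank-one decomposition be indexed by the finite type in which its
    terms naturally live, such as a product of index types. *)
Lemma rank_leP (L I J K : finType) (t : I -> J -> K -> F) :
  rank_le t #|L| <->
  exists (a : L -> I -> F) (b : L -> J -> F) (c : L -> K -> F),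
    forall i j k, t i j k = \sum_l a l i * b l j * c l k.
Proof.
split=> -[a [b [c tE]]].
  exists (a \o enum_rank), (b \o enum_rank), (c \o enum_rank) => i j k.
  by rewrite tE (reindex _ (onW_bij _ (@enum_rank_bij L))).
exists (a \o enum_val), (b \o enum_val), (c \o enum_val) => i j k.
by rewrite tE (reindex _ (onW_bij _ (@enum_val_bij L))).
Qed.

Lemma rank_le_trans r s (I J K : finType) (t : I -> J -> K -> F) :
  (r <= s)%N -> rank_le t r -> rank_le t s.
Proof.
move=> le_rs [a [b [c tE]]].
have -> : s = #|{: 'I_r + 'I_(s - r)}| by rewrite card_sum !card_ord subnKC.
apply/rank_leP.
exists (fun l => if l is inl l' then a l' else fun=> 0).
exists (fun l => if l is inl l' then b l' else fun=> 0).
exists (fun l => if l is inl l' then c l' else fun=> 0) => i j k.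
by rewrite tE big_sumType /= [X in _ + X]big1 ?addr0 // => l _; rewrite !mul0r.
Qed.

(** Setting variables to zero, identifying them and rescaling them acts on each
    rank-one term separately, so it cannot increase the rank. *)
Lemma rank_le_restrict (I J K I' J' K' : finType)
    (t : I -> J -> K -> F) (t' : I' -> J' -> K' -> F)
    (f : I' -> I) (g : J' -> J) (h : K' -> K)
    (u : I' -> F) (v : J' -> F) (w : K' -> F) (r : nat) :
    (forall i j k, t' i j k = u i * v j * w k * t (f i) (g j) (h k)) ->
  rank_le t r -> rank_le t' r.
Proof.
move=> t'E [a [b [c tE]]].
exists (fun l i => u i * a l (f i)), (fun l j => v j * b l (g j)).
exists (fun l k => w k * c l (h k)) => i j k.
by rewrite t'E tE mulr_sumr; apply: eq_bigr => l _; ring.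
Qed.

(** * Tensor products and direct sums of copies *)

Definition tens (I J K I' J' K' : finType)
    (t : I -> J -> K -> F) (t' : I' -> J' -> K' -> F) :
    I * I' -> J * J' -> K * K' -> F :=
  fun x y z => t x.1 y.1 z.1 * t' x.2 y.2 z.2.

Lemma rank_le_tens (I J K I' J' K' : finType)
    (t : I -> J -> K -> F) (t' : I' -> J' -> K' -> F) r r' :
  rank_le t r -> rank_le t' r' -> rank_le (tens t t') (r * r').
Proof.
move=> [a [b [c tE]]] [a' [b' [c' t'E]]].
have -> : (r * r')%N = #|{: 'I_r * 'I_r'}| by rewrite card_prod !card_ord.
apply/rank_leP.
exists (fun l x => a l.1 x.1 * a' l.2 x.2), (fun l y => b l.1 y.1 * b' l.2 y.2).
exists (fun l z => c l.1 z.1 * c' l.2 z.2) => i j k.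
rewrite /tens tE t'E big_distrlr /= pair_bigA /=.
by apply: eq_bigr => l _; ring.
Qed.

(** The direct sum of #|E| copies of [t], on disjoint sets of variables. *)
Definition copies (E I J K : finType) (t : I -> J -> K -> F) :
    E * I -> E * J -> E * K -> F :=
  fun x y z => ((x.1 == y.1) && (y.1 == z.1))%:R * t x.2 y.2 z.2.

Lemma sum_diagonal (E : finType) (f g h : E -> F) :
  \sum_u f u * g u * h u =
  \sum_u \sum_v \sum_w f u * g v * h w * ((u == v) && (v == w))%:R.
Proof.
apply: eq_bigr => u _.
rewrite (bigD1 u) //= (bigD1 u) //= !eqxx mulr1 !big1 ?addr0 //.
  by move=> v /negbTE ne_vu; rewrite big1 // => w _; rewrite eq_sym ne_vu mulr0.
by move=> w /negbTE ne_wu; rewrite eq_sym ne_wu mulr0.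
Qed.

Lemma mul3_sum (E : finType) (f g h : E -> F) :
  (\sum_u f u) * (\sum_u g u) * (\sum_u h u) =
  \sum_u \sum_v \sum_w f u * g v * h w.
Proof.
rewrite big_distrlr /= mulr_suml; apply: eq_bigr => u _.
by rewrite big_distrlr.
Qed.

(** Schoenhage's recycling step. Decompose the copies of [t] into [q] batches of
    #|E| rank-one terms. In [copies E (tens t t')] each term becomes a product of
    linear forms in blocks, carried by its own copy of [t']; a batch is therefore
    one instance of [copies E t'], which costs [p]. *)
Lemma rank_le_copies_tens (E I J K I' J' K' : finType)
    (t : I -> J -> K -> F) (t' : I' -> J' -> K' -> F) (q p : nat) :
    rank_le (copies (E:=E) t) (q * #|E|) -> rank_le (copies (E:=E) t') p ->
  rank_le (copies (E:=E) (tens t t')) (q * p).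
Proof.
have -> : (q * #|E|)%N = #|{: 'I_q * E}| by rewrite card_prod card_ord.
move=> /rank_leP[a [b [c tE]]] [a' [b' [c' t'E]]].
have -> : (q * p)%N = #|{: 'I_q * 'I_p}| by rewrite card_prod !card_ord.
apply/rank_leP.
exists (fun l x => \sum_v a (l.1, v) (x.1, x.2.1) * a' l.2 (v, x.2.2)).
exists (fun l y => \sum_v b (l.1, v) (y.1, y.2.1) * b' l.2 (v, y.2.2)).
exists (fun l z => \sum_v c (l.1, v) (z.1, z.2.1) * c' l.2 (v, z.2.2)).
move=> [u [i i']] [v [j j']] [w [k k']] /=.
pose A l f := a (l, f) (u, i); pose B l f := b (l, f) (v, j).
pose C l f := c (l, f) (w, k).
have -> : copies (tens t t') (u, (i, i')) (v, (j, j')) (w, (k, k')) =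
    copies t (u, i) (v, j) (w, k) * t' i' j' k'.
  by rewrite /copies /tens /= mulrA.
(* Batches are indexed by the first component of 'I_q * E, and within a batch
   the term [f] is carried by the copy [f] of [t']. *)
rewrite tE (_ : \sum_l _ = \sum_l \sum_f A l f * B l f * C l f); last first.
  by rewrite pair_bigA; apply: eq_bigr => -[].
rewrite mulr_suml.
rewrite -(pair_bigA _ (fun l m => (\sum_f A l f * a' m (f, i')) *
  (\sum_f B l f * b' m (f, j')) * (\sum_f C l f * c' m (f, k')))) /=.
apply: eq_bigr => l _; rewrite sum_diagonal mulr_suml.
under [RHS]eq_bigr => m _ do rewrite mul3_sum.
rewrite /= exchange_big; apply: eq_bigr => f _ /=.
rewrite mulr_suml exchange_big; apply: eq_bigr => g _ /=.
rewrite mulr_suml exchange_big; apply: eq_bigr => h _ /=.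
have := t'E (f, i') (g, j') (h, k'); rewrite /copies /= => t'fE.
by rewrite -mulrA t'fE mulr_sumr; apply: eq_bigr => m _; ring.
Qed.

(** * Matrix multiplication tensors *)

Definition matmul (A : finType) (x y z : A * A) : F :=
  [&& x.2 == y.1, y.2 == z.1 & z.2 == x.1]%:R.

Lemma rank_le_pullback (I J K I' J' K' : finType)
    (t : I -> J -> K -> F) (t' : I' -> J' -> K' -> F)
    (f : I' -> I) (g : J' -> J) (h : K' -> K) (r : nat) :
    (forall i j k, t' i j k = t (f i) (g j) (h k)) ->
  rank_le t r -> rank_le t' r.
Proof.
move=> t'E; apply: (rank_le_restrict (f := f) (g := g) (h := h)
  (u := fun=> 1) (v := fun=> 1) (w := fun=> 1)) => i j k.
by rewrite t'E !mul1r.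
Qed.

Definition dup (A B : Type) (f : A -> B) (x : A * A) := (f x.1, f x.2).

Lemma matmul_inj (A B : finType) (f : A -> B) (x y z : A * A) : injective f ->
  matmul x y z = matmul (dup f x) (dup f y) (dup f z).
Proof. by move=> f_inj; rewrite /matmul /= !(inj_eq f_inj). Qed.

Lemma rank_le_matmul_inj (A B : finType) (f : A -> B) r : injective f ->
  rank_le (@matmul B) r -> rank_le (@matmul A) r.
Proof.
move=> f_inj; apply: (rank_le_pullback (f := dup f) (g := dup f) (h := dup f)).
by move=> x y z; apply: matmul_inj.
Qed.

Lemma tens_matmul (A B : finType) (x y z : (A * B) * (A * B)) :
  let unzip u := ((u.1.1, u.2.1), (u.1.2, u.2.2)) in
  matmul x y z = tens (@matmul A) (@matmul B) (unzip x) (unzip y) (unzip z).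
Proof.
case: x y z => [[i i'] [j j']] [[k k'] [l l']] [[m m'] [n n']].
rewrite /matmul /tens /= !xpair_eqE -natrM mulnb; congr (nat_of_bool _)%:R.
by do 3 case: (_ == _); do 3 case: (_ == _).
Qed.

Lemma rank_le_copies_matmul_prod (E A B : finType) (q p : nat) :
    rank_le (copies (E:=E) (@matmul A)) (q * #|E|) ->
    rank_le (copies (E:=E) (@matmul B)) p ->
  rank_le (copies (E:=E) (@matmul (A * B)%type)) (q * p).
Proof.
move=> tA tB; have := rank_le_copies_tens tA tB.
pose f (x : E * ((A * B) * (A * B))) :=
  (x.1, ((x.2.1.1, x.2.2.1), (x.2.1.2, x.2.2.2))).
apply: (rank_le_pullback (f := f) (g := f) (h := f)) => x y z.
by rewrite /copies tens_matmul.
Qed.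

Lemma rank_le_copies_pullback (E I J K I' J' K' : finType)
    (t : I -> J -> K -> F) (t' : I' -> J' -> K' -> F)
    (f : I' -> I) (g : J' -> J) (h : K' -> K) (r : nat) :
    (forall i j k, t' i j k = t (f i) (g j) (h k)) ->
  rank_le (copies (E:=E) t) r -> rank_le (copies (E:=E) t') r.
Proof.
move=> t'E; apply: (rank_le_pullback (f := fun x => (x.1, f x.2))
  (g := fun x => (x.1, g x.2)) (h := fun x => (x.1, h x.2))) => i j k.
by rewrite /copies t'E.
Qed.

Lemma card_inj (A B : finType) :
  (#|A| <= #|B|)%N -> exists f : A -> B, injective f.
Proof.
move=> leAB; exists (fun x => enum_val (widen_ord leAB (enum_rank x))) => x y.
by move=> /enum_val_inj/(congr1 val)/= /val_inj/enum_rank_inj.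
Qed.

(** The base case is #|E| independent scalar products, of rank #|E|. *)
Lemma rank_le_copies_matmul_exp (E : finType) (m q N : nat) :
    rank_le (copies (E:=E) (@matmul 'I_m)) (q * #|E|) ->
  rank_le (copies (E:=E) (@matmul 'I_(m ^ N))) (q ^ N * #|E|).
Proof.
move=> tm; elim: N => [|N IHN].
  rewrite !expn0 mul1n; apply/rank_leP.
  exists (fun l x => (x.1 == l)%:R), (fun l y => (y.1 == l)%:R).
  exists (fun l z => (z.1 == l)%:R) => -[u [i i']] [v [j j']] [w [k k']].
  rewrite /copies /matmul /= !ord1 /= mulr1 (bigD1 u) //= eqxx mul1r.
  rewrite big1 ?addr0 => [|l /negbTE]; last first.
    by rewrite eq_sym => ->; rewrite !mul0r.
  by rewrite -natrM mulnb [v == u]eq_sym; case: eqP => // ->; rewrite eq_sym.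
have := rank_le_copies_matmul_prod tm IHN; rewrite mulnA -expnS.
have [|f f_inj] := @card_inj 'I_(m ^ N.+1) ('I_m * 'I_(m ^ N))%type.
  by rewrite card_prod !card_ord expnS.
apply: (rank_le_copies_pullback (f := dup f) (g := dup f) (h := dup f)).
by move=> x y z; apply: matmul_inj.
Qed.

Lemma rank_le_copies_single (E I J K : finType) (t : I -> J -> K -> F) r :
  (0 < #|E|)%N -> rank_le (copies (E:=E) t) r -> rank_le t r.
Proof.
move=> /card_gt0P[e _]; apply: (rank_le_pullback
  (f := fun x => (e, x)) (g := fun x => (e, x)) (h := fun x => (e, x))).
by move=> x y z; rewrite /copies /= eqxx mul1r.
Qed.

(** A flattening bound: keep one variable of each kind per copy, so that a nonzero
    coefficient survives, and view the result as a matrix with the [x] variables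
    as rows and the pairs of [y] and [z] variables of one copy as columns. It is
    a multiple of the identity of size #|E| and factors through a space of
    dimension [r]. *)
Lemma card_le_rank_copies (E I J K : finType) (t : I -> J -> K -> F) r i j k :
  t i j k != 0 -> rank_le (copies (E:=E) t) r -> (#|E| <= r)%N.
Proof.
move=> nz_t [a [b [c tE]]].
pose A := \matrix_(u < #|E|, l < r) (a l (enum_val u, i) / t i j k).
pose B := \matrix_(l < r, v < #|E|) (b l (enum_val v, j) * c l (enum_val v, k)).
apply: (@mulmx1_min F _ _ A B); apply/matrixP => u v; rewrite !mxE.
under eq_bigr => l _ do rewrite !mxE.
transitivity (copies t (enum_val u, i) (enum_val v, j) (enum_val v, k)
   / t i j k).
  by rewrite tE mulr_suml; apply: eq_bigr => l _; rewrite mulrAC !mulrA.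
rewrite /copies /= eqxx andbT mulfK //.
by rewrite (inj_eq enum_val_inj).
Qed.

(** * Unweighted copies inside the cube of a weighted tensor *)

(** The three maps send an element of [E] to the corners of a triangle, whose
    edges (e1, e2), (e2, e3) and (e3, e1) stand for an [x], a [y] and a [z]
    variable of <n,n,n>. After all variables that are no such edge have been set
    to zero, the remaining monomials are exactly these #|E| independent ones. *)
Definition triangle_matching (E A : Type) (e1 e2 e3 : E -> A) :=
  forall u v w, e1 u = e1 w -> e2 u = e2 v -> e3 v = e3 w -> u = v /\ v = w.

(** The index of an [x] variable of the result is a pair ((i1, i2), (j1, j3)) in
    the copy [u], and similarly for [y] and [z]. The index missing from each
    factor (k in the first, j in the second, i in the third) is supplied by a
    corner of [u], so in each factor the weight depends on a single variable,
    by which it can be divided: [x] in the first, [z] in the second, [y] in the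
    third. The first factor forces [e3 v = e3 w], the second [e2 u = e2 v] and
    the third [e1 u = e1 w], so only terms within one copy survive. *)
Lemma rank_le_copies_cube (E A : finType) (t : A * A -> A * A -> A * A -> F)
    (e1 e2 e3 : E -> A) (r : nat) :
    (forall x y z, (t x y z != 0) = (matmul x y z != 0)) ->
    triangle_matching e1 e2 e3 ->
  rank_le t r -> rank_le (copies (E:=E) (@matmul (A * A)%type)) (r ^ 3).
Proof.
move=> tP eP tr; have := rank_le_tens (rank_le_tens tr tr) tr.
have -> : (r * r * r = r ^ 3)%N by rewrite !expnS expn0 muln1 mulnA.
pose la i j k := t (i, j) (j, k) (k, i).
have la_nz i j k : la i j k != 0.
  by rewrite /la tP /matmul /= !eqxx oner_neq0.
apply: (rank_le_restrict
  (f := fun x : E * ((A * A) * (A * A)) => let: (u, ((i1, i2), (j1, j3))) := x in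
     (((i1, j1), (i2, e2 u)), (e1 u, j3)))
  (g := fun y : E * ((A * A) * (A * A)) => let: (v, ((j1, j3), (k2, k3))) := y in
     (((j1, e3 v), (e2 v, k2)), (j3, k3)))
  (h := fun z : E * ((A * A) * (A * A)) => let: (w, ((k2, k3), (i1, i2))) := z in
     (((e3 w, i1), (k2, i2)), (k3, e1 w)))
  (u := fun x => let: (u, ((i1, i2), (j1, j3))) := x in (la i1 j1 (e3 u))^-1)
  (v := fun y => let: (v, ((j1, j3), (k2, k3))) := y in (la (e1 v) j3 k3)^-1)
  (w := fun z => let: (w, ((k2, k3), (i1, i2))) := z in (la i2 (e2 w) k2)^-1)).
move=> [u [[i1 i2] [j1 j3]]] [v [[j1' j3'] [k2 k3]]] [w [[k2' k3'] [i1' i2']]].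
rewrite /tens /copies /=.
have t0 x y z : ~~ [&& x.2 == y.1, y.2 == z.1 & z.2 == x.1] -> t x y z = 0.
  by move=> nxyz; apply/eqP; rewrite -[_ == _]negbK tP /matmul (negbTE nxyz) eqxx.
(* Within a copy, the three weights cancel against the rescalings. *)
case: (boolP [&& u == v, v == w, j1 == j1', j3 == j3', k2 == k2', k3 == k3',
                 i1 == i1' & i2 == i2']) => [|neq].
  move=> /and5P[/eqP<- /eqP<- /eqP<- /eqP<- /and4P[/eqP<- /eqP<- /eqP<- /eqP<-]].
  rewrite /matmul !eqxx mul1r -/(la i1 j1 (e3 u)) -/(la i2 (e2 u) k2).
  by rewrite -/(la (e1 u) j3 k3) [LHS]/=; field; rewrite !la_nz.
have -> : ((u == v) && (v == w))%:R * matmul (i1, i2, (j1, j3))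
    (j1', j3', (k2, k3)) (k2', k3', (i1', i2')) = 0 :> F.
  rewrite /matmul -natrM mulnb /= !xpair_eqE [i1' == i1]eq_sym [i2' == i2]eq_sym.
  by move: neq; rewrite !andbA => /negbTE ->.
(* Otherwise one of the three factors is off the support of [t]. *)
have [t1|n1] := boolP [&& j1 == j1', e3 v == e3 w & i1' == i1]; last first.
  by rewrite (t0 (i1, j1) (j1', e3 v) (e3 w, i1') n1) !mul0r mulr0.
have [t2|n2] := boolP [&& e2 u == e2 v, k2 == k2' & i2' == i2]; last first.
  by rewrite (t0 (i2, e2 u) (e2 v, k2) (k2', i2') n2) mulr0 mul0r mulr0.
have [t3|n3] := boolP [&& j3 == j3', k3 == k3' & e1 w == e1 u]; last first.
  by rewrite (t0 (e1 u, j3) (j3', k3) (k3', e1 w) n3) !mulr0.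
case/negP: neq; move: t1 t2 t3.
move=> /and3P[-> /eqP e3E /eqP->] /and3P[/eqP e2E -> /eqP->].
move=> /and3P[-> -> /eqP e1E]; have [-> ->] := eP u v w (esym e1E) e2E e3E.
by rewrite !eqxx.
Qed.
End Rank.

(** * Large triangle matchings *)

Lemma pigeonhole (T : finType) (f : T -> nat) (m : nat) :
    (forall x, (f x <= m)%N) ->
  exists t, (#|T| <= #|[pred x | f x == t]| * m.+1)%N.
Proof.
move=> f_le; pose F (i : 'I_m.+1) := #|[pred x | f x == i]|.
case: (@arg_maxnP _ ord0 xpredT F isT) => i _ Fi; exists (i : nat).
rewrite -sum1_card.
rewrite (partition_big (fun x => inord (f x) : 'I_m.+1) xpredT) //=.
have -> : (#|[pred x | f x == i]| * m.+1 = \sum_(j < m.+1) F i)%N.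
  by rewrite sum_nat_const card_ord mulnC.
apply: leq_sum => j _; apply: leq_trans (Fi j isT).
rewrite sum1_card; apply: subset_leq_card; apply/fintype.subsetP => x.
rewrite unfold_in => /eqP <-.
by rewrite inE /= inordK ?ltnS.
Qed.

(** Parallelogram law: |a - b|^2 = 2|a|^2 + 2|b|^2 - |2c|^2 = 0. *)
Lemma sphere_midpoint (k : nat) (a b c : 'I_k -> nat) (t : nat) :
    (\sum_i a i ^ 2 = t)%N -> (\sum_i b i ^ 2 = t)%N ->
    (\sum_i c i ^ 2 = t)%N ->
  (forall i, a i + b i = 2 * c i)%N -> a =1 b /\ b =1 c.
Proof.
move=> aE bE cE mid.
suff ab : a =1 b by split=> // i; have := mid i; rewrite ab; lia.
have sqZ (f : 'I_k -> nat) : \sum_i (f i)%:Z ^+ 2 = (\sum_i f i ^ 2)%N%:Z.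
  by rewrite -natz natr_sum; apply: eq_bigr => i _; rewrite natz -[RHS]natz natrX natz.
have : \sum_i ((a i)%:Z - (b i)%:Z) ^+ 2 = 0 :> int.
  transitivity (\sum_i (2 * (a i)%:Z ^+ 2 + 2 * (b i)%:Z ^+ 2
                        - 4 * (c i)%:Z ^+ 2) : int).
    apply: eq_bigr => i _; have := mid i => /(congr1 Posz).
    rewrite PoszD PoszM => midi.
    have -> : 4 * (c i)%:Z ^+ 2 = (2%:Z * (c i)%:Z) ^+ 2 by ring.
    by rewrite -midi; ring.
  rewrite sumrB big_split /= -!mulr_sumr !sqZ aE bE cE; ring.
move=> /psumr_eq0P sq0 i.
have := sq0 (fun i _ => sqr_ge0 _) i isT.
by move/eqP; rewrite sqrf_eq0 subr_eq0 => /eqP[].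
Qed.

(** Vertices are points of the box [0, 3d)^k. Members of [E] are pairs (x, a) with
    corners x, x + a, x + 2a, where [x] and [a] range over [0, d)^k and |a|^2 has
    the value that is taken most often among the k * d^2 + 1 candidates. Edges of
    three members that close up to a triangle make the third step the midpoint of
    the first two. *)
Lemma triangle_matching_sphere (k d : nat) :
  exists (E : finType) (e1 e2 e3 : E -> 'I_((3 * d) ^ k)),
    triangle_matching e1 e2 e3 /\
    ((d ^ k) ^ 2 <= #|E| * (k * d ^ 2).+1)%N.
Proof.
pose V := {ffun 'I_k -> 'I_d}.
pose normsq (p : V * V) := (\sum_c (p.2 c : nat) ^ 2)%N.
have [|t tE] := @pigeonhole (V * V)%type normsq (k * d ^ 2).
  move=> p; rewrite -[k in (k * _)%N]card_ord -sum_nat_const.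
  by apply: leq_sum => c _; rewrite leq_exp2r // ltnW.
(* [pt s] is the corner x + s * a. *)
have lt3 (s : 'I_3) (x a : 'I_d) : (x + s * a < 3 * d)%N.
  by case: s x a => s /= ? [x /= ?] [a /= ?]; nia.
pose pt (s : 'I_3) (p : V * V) : {ffun 'I_k -> 'I_(3 * d)} :=
  [ffun c => Ordinal (lt3 s (p.1 c) (p.2 c))].
have [|g g_inj] := @card_inj {ffun 'I_k -> 'I_(3 * d)} 'I_((3 * d) ^ k).
  by rewrite card_ffun !card_ord.
have ptE (s s' : nat) (p p' : V * V) : (s < 3)%N -> (s' < 3)%N ->
    g (pt (inord s) p) = g (pt (inord s') p') ->
  forall i : 'I_k, (p.1 i + s * p.2 i = p'.1 i + s' * p'.2 i)%N.
  move=> s3 s'3 /g_inj/ffunP gE i; have /(congr1 val) := gE i.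
  by rewrite !ffunE /= !inordK.
have eq_V (f h : V) : (forall i : 'I_k, f i = h i :> nat) -> f = h.
  by move=> fh; apply/ffunP => i; apply: val_inj; apply: fh.
have match_V (x a y b z c : V) :
    normsq (x, a) = t -> normsq (y, b) = t -> normsq (z, c) = t ->
    g (pt (inord 0) (x, a)) = g (pt (inord 0) (z, c)) ->
    g (pt (inord 1) (x, a)) = g (pt (inord 1) (y, b)) ->
    g (pt (inord 2) (y, b)) = g (pt (inord 2) (z, c)) ->
  (x, a) = (y, b) /\ (y, b) = (z, c).
  move=> na nb nc /(ptE 0 0 (x, a) (z, c) isT isT)%N /= xz.
  move=> /(ptE 1 1 (x, a) (y, b) isT isT)%N /= xy.
  move=> /(ptE 2 2 (y, b) (z, c) isT isT)%N /= yz.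
  have mid (i : 'I_k) : (a i + b i = 2 * c i)%N.
    by have := xz i; have := xy i; have := yz i; lia.
  have [ab bc] := sphere_midpoint na nb nc mid.
  by split; congr (_, _); apply: eq_V => i;
    move: (xz i) (xy i) (ab i) (bc i) => /=; lia.
exists {p : V * V | normsq p == t}.
exists (fun p => g (pt (inord 0) (val p))), (fun p => g (pt (inord 1) (val p))).
exists (fun p => g (pt (inord 2) (val p))); split; last first.
  by move: tE; rewrite card_sig card_prod card_ffun !card_ord mulnn.
move=> [[x a] Pu] [[y b] Pv] [[z c] Pw] xz xy yz.
have [xayb ybzc] := match_V x a y b z c (eqP Pu) (eqP Pv) (eqP Pw) xz xy yz.
by split; apply: val_inj.
Qed.

(** * Ranks of the matrix multiplication tensors *)

Section Interface.
Variable F : fieldType.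

Lemma rank_decompositionP (I J K : finType) (T : tensor F I J K) r :
  rank_decomposition T r <-> rank_le (fun i j k => T (i, j, k)) r.
Proof.
split=> -[a [b [c TE]]].
  exists a, b, c => i j k; rewrite TE sum_ffunE.
  by apply: eq_bigr => l _; rewrite ffunE.
exists (fun l => [ffun i => a l i]), (fun l => [ffun j => b l j]).
exists (fun l => [ffun k => c l k]); apply/ffunP => -[[i j] k].
by rewrite TE sum_ffunE; apply: eq_bigr => l _; rewrite !ffunE.
Qed.

Lemma rank_le_tensor_rank (I J K : finType) (T : tensor F I J K) :
  rank_le (fun i j k => T (i, j, k)) (tensor_rank T).
Proof.
apply/rank_decompositionP; rewrite /tensor_rank.
by case: ex_minnP => r /asboolP.
Qed.

Lemma tensor_rank_le (I J K : finType) (T : tensor F I J K) r :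
  rank_le (fun i j k => T (i, j, k)) r -> (tensor_rank T <= r)%N.
Proof.
move=> /rank_decompositionP Tr; rewrite /tensor_rank.
by case: ex_minnP => s _; apply; apply/asboolP.
Qed.

Lemma s_rank_le_tensor_rank (I J K : finType) (T : tensor F I J K) :
  (s_rank T <= tensor_rank T)%N.
Proof.
by rewrite /s_rank; case: ex_minnP => s _; apply; apply/asboolP; exists T.
Qed.

Lemma s_rank_witness (I J K : finType) (T : tensor F I J K) :
  exists2 T' : tensor F I J K, tensor_supp T' = tensor_supp T &
    rank_le (fun i j k => T' (i, j, k)) (s_rank T).
Proof.
rewrite /s_rank; case: ex_minnP => _ /asboolP[T' suppT' <-] _.
by exists T' => //; apply: rank_le_tensor_rank.
Qed.

Lemma matmul_sum (A : finType) (x y z : A * A) :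
  matmul F x y z = \sum_i \sum_j \sum_k
    (x == (i, j))%:R * (y == (j, k))%:R * (z == (k, i))%:R.
Proof.
case: x y z => [i j] [j' k] [k' i'].
rewrite (bigD1 i) //= [X in _ + X]big1 ?addr0 => [|i0 /negbTE ne]; last first.
  rewrite big1 // => j0 _; rewrite big1 // => k0 _.
  by rewrite xpair_eqE eq_sym ne !mul0r.
rewrite (bigD1 j) //= [X in _ + X]big1 ?addr0 => [|j0 /negbTE ne]; last first.
  by rewrite big1 // => k0 _; rewrite !xpair_eqE [j == _]eq_sym ne andbF !mul0r.
rewrite (bigD1 k) //= [X in _ + X]big1 ?addr0 => [|k0 /negbTE ne]; last first.
  by rewrite !xpair_eqE [k == _]eq_sym ne andbF mulr0 mul0r.
rewrite /matmul /= !xpair_eqE !eqxx mul1r -natrM mulnb.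
by rewrite andbT [j' == j]eq_sym [k' == k]eq_sym.
Qed.

Lemma matmul_tensorE n (x y z : 'I_n * 'I_n) :
  matmul_tensor F n n n (x, y, z) = matmul F x y z.
Proof.
rewrite matmul_sum /matmul_tensor !sum_ffunE; apply: eq_bigr => i _.
rewrite sum_ffunE; apply: eq_bigr => j _; rewrite sum_ffunE.
by apply: eq_bigr => k _; rewrite !ffunE.
Qed.

Lemma rank_le_matmul (A : finType) : rank_le (@matmul F A) (#|A| ^ 3).
Proof.
have -> : (#|A| ^ 3 = #|{: A * (A * A)}|)%N.
  by rewrite !card_prod !expnS expn0 muln1.
apply/rank_leP; exists (fun l x => (x == (l.1, l.2.1))%:R).
exists (fun l y => (y == (l.2.1, l.2.2))%:R).
exists (fun l z => (z == (l.2.2, l.1))%:R) => x y z.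
rewrite matmul_sum; under eq_bigr => i _ do rewrite pair_bigA.
by rewrite pair_bigA.
Qed.

Lemma tensor_rank_matmul_le n r :
  (tensor_rank (matmul_tensor F n n n) <= r)%N <-> rank_le (@matmul F 'I_n) r.
Proof.
split=> [le_r | tr].
  apply: (rank_le_trans le_r); have := rank_le_tensor_rank (matmul_tensor F n n n).
  by apply: (rank_le_pullback (f := id) (g := id) (h := id)) => x y z;
    rewrite matmul_tensorE.
apply: tensor_rank_le; move: tr.
by apply: (rank_le_pullback (f := id) (g := id) (h := id)) => x y z;
  rewrite matmul_tensorE.
Qed.

Lemma tensor_rank_matmul_mono n m : (n <= m)%N ->
  (tensor_rank (matmul_tensor F n n n) <= tensor_rank (matmul_tensor F m m m))%N.
Proof.
move=> le_nm; apply/tensor_rank_matmul_le.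
apply: (@rank_le_matmul_inj _ _ _ (widen_ord le_nm)).
  by move=> i j /(congr1 val) /= /val_inj.
exact/tensor_rank_matmul_le.
Qed.

Lemma tensor_rank_matmul_gt0 n : (0 < n)%N ->
  (0 < tensor_rank (matmul_tensor F n n n))%N.
Proof.
case: n => // n _; rewrite lt0n; apply/negP => /eqP r0.
have /tensor_rank_matmul_le[a [b [c tE]]] : (tensor_rank
  (matmul_tensor F n.+1 n.+1 n.+1) <= 0)%N by rewrite r0.
have := tE (ord0, ord0) (ord0, ord0) (ord0, ord0).
by rewrite big_ord0 /matmul /= => /eqP; rewrite oner_eq0.
Qed.
End Interface.

(** * Exponents *)

Section Growth.
Variable R : realType.

Lemma le_ln (x y : R) : 0 < x -> x <= y -> ln x <= ln y.
Proof. by move=> x_gt0 le_xy; rewrite ler_ln // posrE (lt_le_trans x_gt0). Qed.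

(** The logarithm tends to infinity. Used to pass to the limit in an inequality
    between powers of [n] with unknown constants. *)
Lemma ln_slope_le0 (a b : R) (N : nat) :
  (forall n, (N <= n)%N -> a * ln n%:R <= b) -> a <= 0.
Proof.
move=> bnd; rewrite leNgt; apply/negP => a_gt0.
pose x : R := expR (b / a + 1).
have x_gt0 : 0 < x by exact: expR_gt0.
pose n := maxn N (Num.truncn x).+1.
have lexn : x <= n%:R.
  apply: ltW; apply: (lt_le_trans (truncnS_gt _)).
  by rewrite ler_nat leq_maxr.
have := bnd n (leq_maxl _ _); apply/negP; rewrite -ltNge.
have : b / a + 1 <= ln n%:R.
  by rewrite -[leLHS]expRK ler_ln // posrE // (lt_le_trans x_gt0).
rewrite -(ler_pM2l a_gt0); apply: lt_le_trans.
by rewrite mulrDr mulr1 mulrCA divff ?gt_eqF // mulr1 ltrDl.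
Qed.

Lemma bigO_powRP (f : nat -> nat) (tau : R) :
  ((fun n : nat => (f n)%:R : R^o) =O_\oo
   (fun n : nat => n%:R `^ tau : R^o))%classic <->
  exists (C : R) (N : nat), 0 < C /\
    forall n, (N <= n)%N -> (f n)%:R <= C * n%:R `^ tau.
Proof.
split.
  move=> /eqO_exP[C C_gt0 [N _ NP]]; exists C, N; split=> // n /NP /=.
  by rewrite !ger0_norm ?powR_ge0.
move=> [C [N [C_gt0 NP]]]; apply/eqO_exP; exists C => //; exists N => // n /NP /=.
by rewrite !ger0_norm ?powR_ge0.
Qed.

(** A positive integer sequence has no negative exponent, so the set whose infimum
    is taken is bounded below and the infimum is at most each of its elements. *)
Lemma growth_exponent_le (f : nat -> nat) (tau : R) (C : R) (N : nat) :
    (forall n, (0 < n)%N -> (0 < f n)%N) -> 0 < C ->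
    (forall n, (N <= n)%N -> (f n)%:R <= C * n%:R `^ tau) ->
  growth_exponent R f <= tau.
Proof.
move=> f_gt0 C_gt0 f_le; apply: ge_inf; last by apply/bigO_powRP; exists C, N.
exists 0 => {f_le C_gt0 tau} t /bigO_powRP[{}C [{}N [C_gt0 f_le]]].
rewrite -oppr_le0; apply: (@ln_slope_le0 _ (ln C) (maxn 1 N)) => n.
rewrite geq_max => /andP[n_gt0 /f_le le_fn].
have nR : 0 < n%:R :> R by rewrite ltr0n.
have /(le_ln ltr01) : 1 <= C * n%:R `^ t.
  by apply: le_trans le_fn; rewrite ler1n f_gt0.
rewrite ln1 lnM ?posrE ?powR_gt0 //.
by rewrite ln_powR; lra.
Qed.

(** A bound along the powers of [m] suffices: a monotone [f] is squeezed between
    consecutive powers, at the price of the constant factor [q * s]. *)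
Lemma growth_exponent_le_ratio (f : nat -> nat) (m q s : nat) :
    (forall n, (0 < n)%N -> (0 < f n)%N) -> {homo f : a b / (a <= b)%N} ->
    (1 < m)%N -> (0 < q)%N -> (forall N, (f (m ^ N) <= q ^ N * s)%N) ->
  growth_exponent R f <= ln q%:R / ln m%:R.
Proof.
move=> f_gt0 f_mono m_gt1 q_gt0 f_le.
have s_gt0 : (0 < s)%N.
  by have := leq_trans (f_gt0 1%N isT) (f_le 0%N); rewrite expn0 mul1n.
have mR : 1 < m%:R :> R by rewrite ltr1n.
have lnm_gt0 : 0 < ln m%:R :> R by exact: ln_gt0.
pose tau : R := ln q%:R / ln m%:R; rewrite -/tau.
have tau_ge0 : 0 <= tau by apply: divr_ge0; rewrite ln_ge0 // ler1n // ltnW.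
have m_tau : m%:R `^ tau = q%:R.
  rewrite /powR gt_eqF ?(lt_trans ltr01) // /tau divfK ?gt_eqF //.
  by rewrite lnK // posrE ltr0n.
apply: (@growth_exponent_le _ _ (q * s)%:R 1) => //.
  by rewrite ltr0n muln_gt0 q_gt0.
move=> n n_gt0; set N := trunc_log m n.
have [le_mN lt_nm] := andP (trunc_log_bounds m_gt1 n_gt0).
apply: (@le_trans _ _ (q ^ N.+1 * s)%:R).
  by rewrite ler_nat (leq_trans _ (f_le _)) // f_mono // ltnW.
rewrite expnS mulnAC natrM ler_wpM2l ?ler0n //.
have -> : (q ^ N)%:R = (m ^ N)%:R `^ tau :> R.
  rewrite !natrX -m_tau -(powR_mulrn N (powR_ge0 _ _)).
  by rewrite -(powR_mulrn N (ler0n R m)) -!powRrM mulrC.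
by rewrite ge0_ler_powR ?nnegrE ?ler0n // ler_nat.
Qed.

(** The factor 2 pays for rounding r^3 / #|E| up to an integer [q], which at
    most doubles it because #|E| <= r^3. *)
Lemma omega_le_triangle_matching (n : nat) (E : finType) (e1 e2 e3 : E -> 'I_n) :
    (1 < n)%N -> (0 < #|E|)%N -> triangle_matching e1 e2 e3 ->
  #|E|%:R * n%:R `^ (2 * omega R) <=
    2 * (s_rank (matmul_tensor R[i] n n n))%:R ^+ 3 :> R.
Proof.
move=> n_gt1 E_gt0 eP; set r := s_rank _.
have [T suppT rT] := s_rank_witness (matmul_tensor R[i] n n n).
have tP x y z : (T (x, y, z) != 0) = (matmul R[i] x y z != 0).
  by have /setP/(_ (x, y, z)) := suppT; rewrite !inE matmul_tensorE.
have rankE := rank_le_copies_cube tP eP rT; rewrite -/r in rankE.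
have leEr : (#|E| <= r ^ 3)%N.
  have i0 : 'I_n by case: (n) n_gt1 => // k _; exact: ord0.
  pose d0 := ((i0, i0), (i0, i0)).
  apply: (@card_le_rank_copies _ _ _ _ _ _ _ d0 d0 d0 _ rankE).
  by rewrite /matmul !eqxx oner_neq0.
have [f f_inj] := @card_inj 'I_(n ^ 2) ('I_n * 'I_n)%type
  ltac:(by rewrite card_prod !card_ord).
pose q := (r ^ 3 %/ #|E|).+1.
have rankE' : rank_le (copies (E:=E) (@matmul R[i] 'I_(n ^ 2))) (q * #|E|).
  apply: (rank_le_trans (ltnW (ltn_ceil _ E_gt0))).
  apply: (rank_le_copies_pullback (f := dup f) (g := dup f) (h := dup f)) rankE.
  by move=> x y z; apply: matmul_inj.
have le_omega : omega R <= ln q%:R / ln (n ^ 2)%:R.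
  apply: (@growth_exponent_le_ratio _ _ _ #|E|) => //.
  - exact: tensor_rank_matmul_gt0.
  - exact: tensor_rank_matmul_mono.
  - by rewrite -(exp1n 2) ltn_exp2r.
  move=> N; apply/tensor_rank_matmul_le.
  exact: rank_le_copies_single E_gt0 (rank_le_copies_matmul_exp N rankE').
have nR : 1 < n%:R :> R by rewrite ltr1n.
have lnn_gt0 : 0 < ln n%:R :> R by exact: ln_gt0.
have le_q : n%:R `^ (2 * omega R) <= q%:R.
  rewrite -[leRHS]lnK ?posrE ?ltr0n // /powR gt_eqF ?(lt_trans ltr01) //.
  rewrite ler_expR mulrAC [_ * omega R]mulrC -ler_pdivlMr ?mulr_gt0 //.
  by move: le_omega; rewrite natrX lnXn ?(lt_trans ltr01) // mulr_natl.
apply: (@le_trans _ _ (#|E| * q)%:R).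
  by rewrite natrM ler_wpM2l // ler0n.
rewrite -natrX -natrM ler_nat mulnC mul2n -addnn /q mulSn leq_add //.
exact: leq_divM.
Qed.

(** Take n = (3d)^k. For fixed [k] and large [d], comparing the coefficients of ln d
    in the logarithm of [omega_le_triangle_matching] gives
    (2 omega + 2 - 3 tau) k <= 2, where the 2 on the right is the loss d^2 from
    the choice of the sphere; then [k] tends to infinity. *)
Lemma omega_le_s_rank_growth (tau C : R) (N : nat) : 0 < C ->
    (forall n, (N <= n)%N ->
       (s_rank (matmul_tensor R[i] n n n))%:R <= C * n%:R `^ tau) ->
  2 * omega R + 2 <= 3 * tau.
Proof.
move=> C_gt0 s_le; set w := omega R.
have slope (k : nat) : (0 < k)%N -> (2 * w + 2 - 3 * tau) * k%:R <= 2.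
  move=> k_gt0; rewrite -subr_le0.
  apply: (@ln_slope_le0 _ (ln 2 + 3 * ln C + ln k.+1%:R +
    (3 * tau - 2 * w) * k%:R * ln 3) (maxn 2 N)) => d.
  rewrite geq_max => /andP[d_gt1 le_Nd].
  have d_gt0 : (0 < d)%N := ltnW d_gt1.
  have [E [e1 [e2 [e3 [eP leE]]]]] := triangle_matching_sphere k d.
  set n := ((3 * d) ^ k)%N in e1 e2 e3 eP *.
  have le_dn : (d <= n)%N.
    rewrite (leq_trans (leq_pmull d (isT : 0 < 3)%N)) //.
    by rewrite -[leqLHS]expn1 leq_pexp2l // muln_gt0.
  have E_gt0 : (0 < #|E|)%N.
    rewrite -(ltn_pmul2r (ltn0Sn (k * d ^ 2))) mul0n.
    by rewrite (leq_trans _ leE) // !expn_gt0 d_gt0.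
  have := omega_le_triangle_matching (leq_trans d_gt1 le_dn) E_gt0 eP.
  have := s_le n (leq_trans le_Nd le_dn); set r := s_rank _ => le_r le_E.
  have lnd := d_gt0; rewrite -(ltr0n R) in lnd.
  have n_gt0 : 0 < n%:R :> R by rewrite ltr0n (leq_trans d_gt0).
  have lnn : ln n%:R = k%:R * (ln 3 + ln d%:R) :> R.
    by rewrite /n natrX natrM lnXn ?mulr_gt0 // lnM ?posrE // mulr_natl.
  have EE_gt0 : 0 < #|E|%:R :> R by rewrite ltr0n.
  (* The size of the matching: d^(2k) <= #|E| (k d^2 + 1) <= #|E| (k + 1) d^2. *)
  have lnE : 2 * k%:R * ln d%:R <= ln #|E|%:R + (ln k.+1%:R + 2 * ln d%:R) :> R.
    have -> : 2 * k%:R * ln d%:R = ln ((d ^ k) ^ 2)%:R :> R.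
      rewrite (natrX _ (d ^ k) 2) (natrX _ d k) lnXn ?exprn_gt0 // lnXn //.
      by rewrite -[ln d%:R *+ k]mulr_natl; ring.
    have -> : ln k.+1%:R + 2 * ln d%:R = ln (k.+1 * d ^ 2)%:R :> R.
      rewrite natrM natrX lnM ?posrE ?exprn_gt0 ?ltr0n // lnXn //.
      by rewrite mulr_natl.
    rewrite -lnM ?posrE // -?natrM ?ltr0n ?muln_gt0 ?expn_gt0 ?d_gt0 //.
    rewrite ler_ln ?posrE ?ltr0n ?muln_gt0 ?expn_gt0 ?d_gt0 ?E_gt0 //.
    rewrite ler_nat (leq_trans leE) // leq_mul2l mulSn -addn1 addnC leq_add2r.
    by rewrite expn_gt0 d_gt0 orbT.
  have pow_gt0 (x : R) : 0 < n%:R `^ x by rewrite powR_gt0.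
  have /(le_ln (mulr_gt0 EE_gt0 (pow_gt0 _))) :
      #|E|%:R * n%:R `^ (2 * w) <= 2 * (C * n%:R `^ tau) ^+ 3.
    rewrite (le_trans le_E) // ler_pM2l // lerXn2r ?nnegrE ?ler0n //.
    by rewrite mulr_ge0 ?powR_ge0 // ltW.
  have base_gt0 : 0 < C * n%:R `^ tau by rewrite mulr_gt0.
  rewrite (lnM EE_gt0 (pow_gt0 _)) (lnM (ltr0Sn R 1) (exprn_gt0 3 base_gt0)).
  rewrite (lnXn 3 base_gt0) (lnM C_gt0 (pow_gt0 _)) !ln_powR lnn -[_ *+ 3]mulr_natl.
  move: lnE; nra.
rewrite leNgt -subr_gt0; apply/negP => gap.
set g := _ - _ in gap slope.
pose k := (Num.truncn (2 / g)).+1.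
have := slope k isT; apply/negP; rewrite -ltNge mulrC -ltr_pdivrMr //.
exact: truncnS_gt.
Qed.

End Growth.

Theorem theorem3p6 (R : realType) :
  omega R <= (3 * omega_s R - 2) / 2.
Proof.
suff : (2 * omega R + 2) / 3 <= omega_s R by lra.
apply: lb_le_inf.
  (* The infimum is over a nonempty set: the s-rank is at most n^3. *)
  exists 3%:R => /=; apply/bigO_powRP; exists 1, 0%N; split=> // n _.
  rewrite mul1r powR_mulrn ?ler0n // -natrX ler_nat.
  apply: leq_trans (s_rank_le_tensor_rank _) _; apply/tensor_rank_matmul_le.
  by rewrite -[n in (n ^ 3)%N]card_ord; exact: rank_le_matmul.
move=> tau /bigO_powRP[C [N [C_gt0 s_le]]].
by have := omega_le_s_rank_growth C_gt0 s_le; lra.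
Qed.
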